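(* Fix the base dimension $m$, a positive integer. For integers $k\ge 1$ and $r\ge 0$, let $N(k,r)$ be the number of code words of length $k$ (for base dimension $m$) in which the last subscript has cardinality $r$. Assume that $k\ge 2$ and $1\le r\le k-1$. Then $$N(k,r)=\sum_{i=r-1}^{m-1}\binom{i+1}{r}\,N(k-1,i).$$ Also, for $k\ge 2$, $$N(k,0)=\sum_{i=0}^{m-1}N(k-1,i),$$ which is the total number of code words of length $k-1$. The initial values for these recursive formulas are $N(1,0)=1$ and $N(1,r)=0$ for $r>0$.
   Context: Symbols are $V_A$, where $A$ (the subscript) is a finite set of integers strictly greater than $1$. A code word of length $k$ (for base dimension $m$) is a sequence $V_{A_1}V_{A_2}\cdots V_{A_k}$ of symbols such that: $A_1=\emptyset$; for each $j=2,\dots,k$, $A_j\subseteq A_{j-1}\cup\{j\}$; and $|A_j|<m$ for all $j$. The last subscript is $A_k$.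
   Formalization: The first recursion is proved for r ≠ m; at r = m ≤ k−1 it is false, since N(k,m) = 0 while the sum equals N(k−1,m−1) ≥ 1 (e.g. m = 1, k = 2, r = 1). *)

(* Defs.v *)
From mathcomp Require Import all_boot finmap.
From mathcomp Require Import all_classical.

Set Implicit Arguments.
Unset Strict Implicit.
Unset Printing Implicit Defensive.

(* The symbol V_A is represented by its subscript A. *)
Definition is_symbol (A : {fset nat}) : Prop := forall x, x \in A -> 1 < x.

(* Sequences are numbered from 1: [subscript w j] is A_j when w stands for
   V_{A_1} ... V_{A_k} and 1 <= j <= k. *)
Definition subscript (w : seq {fset nat}) (j : nat) : {fset nat} :=
  nth fset0 w (j - 1).

(* Meant for k >= 1. *)
Definition is_code_word (m k : nat) (w : seq {fset nat}) : Prop :=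
  [/\ size w = k,
      forall j, 1 <= j <= k -> is_symbol (subscript w j),
      subscript w 1 = fset0,
      forall j, 2 <= j <= k ->
        (subscript w j `<=` subscript w (j - 1) `|` [fset j])%fset
    & forall j, 1 <= j <= k -> #|` subscript w j| < m].

Definition code_words (m k : nat) : set (seq {fset nat}) :=
  [set w | is_code_word m k w]%classic.

Definition code_words_last (m k r : nat) : set (seq {fset nat}) :=
  [set w | is_code_word m k w /\ #|` subscript w k| = r]%classic.

(* [fset_set] sends infinite sets to the empty one; the lemmas
   [finite_code_words] and [finite_code_words_last] below show that both
   definitions really count. *)
Definition num_code_words (m k : nat) : nat := #|` fset_set (code_words m k)|.

Definition N (m k r : nat) : nat := #|` fset_set (code_words_last m k r)|.

Lemma code_word_bound m k w : is_code_word m k w ->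
  forall j, j < k -> forall x, x \in nth fset0 w j -> x < k.+1.
Proof.
case=> _ _ w1 wS _; elim=> [|j IHj] jk x.
  by move: w1; rewrite /subscript subnn => ->; rewrite inE.
have /wS /fsubsetP/(_ x) : 2 <= j.+2 <= k by [].
rewrite /subscript !subn1 /= => sub /sub; rewrite !inE => /orP[|/eqP->//].
exact: IHj (ltnW jk) x.
Qed.

Lemma finite_code_words m k : finite_set (code_words m k).
Proof.
pose S : {fset {fset nat}} := fpowerset [fset val i | i in 'I_k.+1]%fset.
apply: (@sub_finite_set _ _
  ((fun t : k.-tuple S => map val t) @` [set: k.-tuple S])%classic); last first.
  by apply: finite_image; exact: finite_finset.
move=> w wP /=; have sz : size w = k by case: wP.
have wS A : A \in w -> A \in S.
  move=> /(nthP fset0)[j]; rewrite sz => jk <-.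
  rewrite fpowersetE; apply/fsubsetP => x xj.
  have xk := code_word_bound wP jk xj.
  by apply/imfsetP; exists (Ordinal xk).
have [s sw] : exists s : seq S, map val s = w.
  elim: w wS {wP sz} => [|A w IHw] wS; first by exists [::].
  have [|s <-] := IHw; first by move=> B Bw; apply: wS; rewrite inE Bw orbT.
  by exists ([` wS A (mem_head A w)]%fset :: s).
have ss : size s == k by rewrite -sz -sw size_map.
by exists (Tuple ss).
Qed.

Lemma finite_code_words_last m k r : finite_set (code_words_last m k r).
Proof. by apply: sub_finite_set (finite_code_words m k) => w []. Qed.

(* Main.v *)
Require Import Defs.
From mathcomp Require Import all_boot finmap.
From mathcomp Require Import all_classical.

(** A code word of length [k + 1] is a code word of length [k] followed by a
    subset of [A_k] enlarged by the new letter [k + 1], which never belongs to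
    [A_k]; hence a word whose last subscript has [i] elements has
    ['C(i + 1, r)] extensions with last subscript of size [r]. *)

(** Transports [card_draws] from the finite type of elements of [A]: taking the image under [val] is
    injective, with left inverse [fsub A], and preserves cardinality. *)
Lemma card_fdraws (K : choiceType) (A : {fset K}) (r : nat) :
  #|` [fset B in fpowerset A | #|` B| == r]%fset| = 'C(#|` A|, r).
Proof.
rewrite [in RHS]cardfE -card_draws.
have inj : injective (fun Y : {set A} => [fset val y | y in Y]%fset).
  by apply: (can_inj (g := fsub A)) => Y; exact: FSetK.
transitivity #|` [fset [fset val y | y in Y]
    | Y : {set A} in finset (fun Y : {set A} => #|Y| == r)]%fset|; last first.
  by rewrite card_imfset //= cardE.
congr #|` _|; apply/fsetP => B; rewrite !inE /= fpowersetE.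
apply/andP/imfsetP => [[BA /eqP Br]|[Y /=]].
  by exists (fsub A B); rewrite ?fsubK //= inE card_fsub // Br.
have sub : ([fset val y | y in Y] `<=` A)%fset.
  by apply/fsubsetP => _ /imfsetP[y _ ->]; exact: valP.
by rewrite inE => Yr ->; split => //; rewrite -(card_fsub sub) FSetK.
Qed.

Lemma in_code_words m k (w : seq {fset nat}) :
  w \in fset_set (code_words m k) <-> is_code_word m k w.
Proof. by rewrite in_fset_set ?in_setE //; exact: finite_code_words. Qed.

Lemma in_code_words_last m k r (w : seq {fset nat}) :
  w \in fset_set (code_words_last m k r) <->
  is_code_word m k w /\ #|` subscript w k| = r.
Proof. by rewrite in_fset_set ?in_setE //; exact: finite_code_words_last. Qed.

Lemma subscript_rcons {w : seq {fset nat}} (B : {fset nat}) {j} :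
  1 <= j <= size w -> subscript (rcons w B) j = subscript w j.
Proof.
by case: j => // j /= jw; rewrite /subscript subn1 /= nth_rcons jw.
Qed.

Lemma subscript_rcons_last (w : seq {fset nat}) (B : {fset nat}) :
  subscript (rcons w B) (size w).+1 = B.
Proof. by rewrite /subscript subn1 /= nth_rcons ltnn eqxx. Qed.

(** Each condition on a word concerns one position or two consecutive ones, so appending [B] only
    adds conditions at position [k.+1]. That [B] is a symbol follows from the inclusion: its
    elements lie in the symbol [subscript w k] or equal [k.+1], which exceeds 1. *)
Lemma code_word_rcons {m k w} {B : {fset nat}} : 0 < k ->
  is_code_word m k.+1 (rcons w B) <->
  [/\ is_code_word m k w, (B `<=` subscript w k `|` [fset k.+1])%fset
    & #|` B| < m].
Proof.
move=> k0; split=> [[]|[[sz wsym w1 wS wm] BS Bm]].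
  rewrite size_rcons => -[sz] wsym w1 wS wm; subst k.
  have le j : 1 <= j <= size w -> 1 <= j <= (size w).+1.
    by case/andP=> -> /leqW.
  split; last 1 first.
  - by have := wm (size w).+1; rewrite subscript_rcons_last; apply; rewrite /= leqnn.
  - split=> //.
    + by move=> j jw; rewrite -(subscript_rcons B jw); apply/wsym/le.
    + by rewrite -w1 subscript_rcons //= k0.
    + move=> j /andP[j2 jw].
      have j1w : 1 <= j - 1 <= size w by rewrite subn_gt0 j2 (leq_trans (leq_subr _ _)).
      have {}jw : 1 <= j <= size w by rewrite (ltnW j2).
      rewrite -(subscript_rcons B jw) -(subscript_rcons B j1w).
      by apply: wS; rewrite j2; case/le/andP: jw.
    + by move=> j jw; rewrite -(subscript_rcons B jw); apply/wm/le.
  - have := wS (size w).+1; rewrite subscript_rcons_last subn1 /=.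
    rewrite subscript_rcons; last by rewrite k0 leqnn.
    by apply; rewrite ltnS k0 leqnn.
have wk j : 1 <= j <= k.+1 -> j = k.+1 \/ 1 <= j <= size w.
  by rewrite sz => /andP[-> /=]; rewrite leq_eqVlt => /orP[/eqP|]; [left|right].
have lastB : subscript (rcons w B) k.+1 = B by rewrite -sz subscript_rcons_last.
split.
- by rewrite size_rcons sz.
- move=> j /wk[->|jw]; last by rewrite subscript_rcons //; apply: wsym; rewrite -sz.
  rewrite lastB => x /(fsubsetP BS); rewrite !inE => /orP[|/eqP->//].
  by apply: wsym; rewrite k0 leqnn.
- by rewrite subscript_rcons // sz.
- move=> j /andP[j2 jk]; have /wk[jE|jw] : 1 <= j <= k.+1 by rewrite (ltnW j2).
    by rewrite jE lastB subn1 subscript_rcons // sz k0 leqnn.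
  have {}jk : j <= k by case/andP: jw => _; rewrite sz.
  rewrite !subscript_rcons //; first by apply: wS; rewrite j2.
  by rewrite subn_gt0 j2 sz (leq_trans (leq_subr _ _)).
- move=> j /wk[->|jw]; first by rewrite lastB.
  by rewrite subscript_rcons //; apply: wm; rewrite -sz.
Qed.

(** Since [r < m], every subset of size [r] meets the bound on cardinalities, so all of them give
    extensions. *)
Lemma N_rcons m k r : 0 < k -> r < m ->
  N m k.+1 r =
  \sum_(w <- fset_set (code_words m k)) 'C(#|` subscript w k| + 1, r).
Proof.
move=> k0 rm.
pose ext (w : seq {fset nat}) : {fset seq {fset nat}} :=
  [fset rcons w B | B in [fset B in fpowerset (subscript w k `|` [fset k.+1])
                                                | #|` B| == r]]%fset.
have -> : N m k.+1 r =
    #|` (\bigcup_(w <- fset_set (code_words m k)) ext w)%fset|.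
  congr #|` _|; apply/fsetP => w.
  apply/idP/bigfcupP => [/in_code_words_last[]|[v]].
    case/lastP: w => [[]//|w B] wB.
    have szw : size w = k by case: wB => /eqP; rewrite size_rcons eqSS => /eqP.
    rewrite -{1}szw subscript_rcons_last => Br.
    have /(code_word_rcons k0)[ww BS _] := wB.
    exists w; first by rewrite andbT; apply/in_code_words.
    by apply/imfsetP; exists B => //=; rewrite !inE /= fpowersetE BS Br /=.
  rewrite andbT => /in_code_words vw /imfsetP[B /=].
  rewrite !inE /= fpowersetE => /andP[BS /eqP Br] ->.
  have szv : size v = k by case: vw.
  apply/in_code_words_last; rewrite -{2}szv subscript_rcons_last; split=> //.
  by apply/code_word_rcons => //; split=> //; rewrite Br.
(* The sets [ext w] are pairwise disjoint because [rcons w B] determines [w]; hence the cardinality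
   of the union is a sum. *)
rewrite card_fset_sum1 partition_disjoint_bigfcup; last first.
  move=> v w _ _; move=> vw; apply/fdisjointP => _ /imfsetP[B _ ->].
  by apply/imfsetP => -[C _ /rcons_inj[]] vwE; rewrite vwE eqxx in vw.
rewrite big_seq [RHS]big_seq; apply: eq_bigr => w /in_code_words ww.
rewrite -card_fset_sum1 card_imfset /=; last by move=> B C /rcons_inj[].
rewrite card_fdraws fsetUC cardfsU1.
suff -> : k.+1 \notin subscript w k by rewrite addnC.
apply/negP => kw; have : k.+1 < k.+1; last by rewrite ltnn.
by apply: (code_word_bound ww _ kw); rewrite subn1 prednK.
Qed.

(** Groups the words by the size of their last subscript. A binomial [F] yields the recursion, and
    the constant 1 yields the total count. *)
Lemma sum_code_words m k (F : nat -> nat) : 0 < k ->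
  \sum_(w <- fset_set (code_words m k)) F #|` subscript w k| =
  \sum_(0 <= i < m) F i * N m k i.
Proof.
move=> k0.
(* Each value of [F] becomes a sum over [i < m] with one surviving index, in range because
   subscripts have fewer than [m] elements; then the two sums are exchanged. *)
transitivity (\sum_(w <- fset_set (code_words m k))
    \sum_(0 <= i < m | i == #|` subscript w k|) F i).
  rewrite big_seq [RHS]big_seq; apply: eq_bigr => w /in_code_words[_ _ _ _ wm].
  by rewrite big_nat1_eq /= wm // k0 leqnn.
under eq_bigr do rewrite big_mkcond /=.
rewrite exchange_big /=; apply: eq_bigr => i _.
rewrite -big_mkcond big_fset_condE /= -[F i]muln1 -big_distrr /= -card_fset_sum1.
rewrite muln1; congr (_ * #|` _|); apply/fsetP => w; rewrite !inE /=.
apply/andP/idP => [[/in_code_words ww /eqP wi]|].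
  by apply/in_code_words_last; split.
by case/in_code_words_last => /in_code_words ww ->.
Qed.

(** The case [r = m] is excluded because the first formula fails there: its left side is 0, while
    its right side is the single term [N m (k - 1) (m - 1)], which is positive when [m <= k - 1]. *)
Theorem mainTheorem2 (m : nat) (hm : 0 < m) :
  (forall k r : nat, 2 <= k -> 1 <= r <= k - 1 -> r <> m ->
     N m k r = \sum_(r - 1 <= i < m) 'C(i + 1, r) * N m (k - 1) i)
  /\ (forall k : nat, 2 <= k ->
        N m k 0 = \sum_(0 <= i < m) N m (k - 1) i
        /\ \sum_(0 <= i < m) N m (k - 1) i = num_code_words m (k - 1))
  /\ N m 1 0 = 1
  /\ (forall r : nat, 0 < r -> N m 1 r = 0).
Proof.
have [N10 N1r] : N m 1 0 = 1 /\ (forall r, 0 < r -> N m 1 r = 0).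
  have code1 w : is_code_word m 1 w <-> w = [:: fset0].
    split=> [[]|->]; first by case: w => [|A []] // _ _; rewrite /subscript /= => ->.
    by split=> // -[|[|j]] // _.
  split=> [|r r0].
    rewrite /N; suff -> : fset_set (code_words_last m 1 0) = [fset [:: fset0]]%fset.
      by rewrite cardfs1.
    apply/fsetP => w; rewrite inE; apply/idP/eqP.
      by case/in_code_words_last => /code1.
    by move=> ->; apply/in_code_words_last; split; [exact/code1 | rewrite cardfs0].
  apply/eqP; rewrite cardfs_eq0; apply/eqP/fsetP => w; rewrite inE.
  apply/negP => /in_code_words_last[/code1 ->].
  by rewrite cardfs0 => rE; rewrite -rE in r0.
(* From here [k] is the length of the shorter words, and the words counted on the left have length
   [k.+1]. *)
split; [|split=> //] => -[//|k] => [r|] /ltnSE k0; rewrite subn1 /=; last first.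
  have sumN : \sum_(0 <= i < m) N m k i =
      \sum_(w <- fset_set (code_words m k)) 1.
    by rewrite (@sum_code_words _ _ (fun=> 1)) //; apply: eq_bigr => i; rewrite mul1n.
  split; last by rewrite sumN -card_fset_sum1.
  by rewrite N_rcons // sumN; apply: eq_bigr => w _; rewrite bin0.
case/andP=> r0 _ /eqP; rewrite neq_ltn => /orP[rm|mr].
  rewrite N_rcons // (@sum_code_words _ _ (fun i => 'C(i + 1, r))) //.
  (* The sum obtained starts at 0; its terms with [i < r - 1] vanish since then [i + 1 < r]. *)
  have r1m : r - 1 <= m by rewrite leq_subLR (leq_trans (ltnW rm)) ?leq_addl.
  rewrite (big_cat_nat (n := r - 1)) //= big_nat big1 ?add0n // => i /andP[_ ir].
  by rewrite bin_small // addn1 -ltn_predRL -subn1.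
(* For [m < r] both sides are 0: the range of summation is empty, and no subscript of a code word
   has [r] elements. *)
rewrite big_geq; last by rewrite subn1 -ltnS prednK.
apply/eqP; rewrite cardfs_eq0; apply/eqP/fsetP => w; rewrite inE.
apply/negP => /in_code_words_last[[_ _ _ _ wm] wr].
have := wm k.+1; rewrite wr leqnn => /(_ isT) rm.
by have := ltn_trans mr rm; rewrite ltnn.
Qed.
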